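(* Let $X$ be an infinite-dimensional Fréchet space over $\mathbb{K}\in\{\mathbb{R},\mathbb{C}\}$, let $(p_j)_{j\in\mathbb{N}}$ be a separating increasing sequence of seminorms inducing the topology of $X$, let $d(x,y)=\sum_{j=1}^\infty 2^{-j}\min(1,p_j(x-y))$, and let $T\colon X\to X$ be a continuous linear operator. Then the following assertions are equivalent: (1) $T$ admits a dense set of distributionally semi-irregular vectors of type $2$; (2) $T$ admits a residual set of distributionally $m$-irregular vectors of type $2$ for some $m\in\mathbb{N}$; (3) there exist $m\in\mathbb{N}$ and $\delta>0$ such that for every sequence $(O_j)_{j\in\mathbb{N}}$ of nonempty open subsets of $X$, there exists a sequence $(K_j)_{j\in\mathbb{N}}$ of Cantor sets with $K_j\subset O_j$ such that $\bigcup_{j=1}^\infty K_j$ is distributionally $m$-extremely $\delta$-scrambled of type $2$; (4) the distributionally proximal relation of $T$ is dense in $X\times X$ and $T$ is mean-L-unstable; (5) the distributionally proximal cell of $\mathbf{0}$ is dense in $X$ and there exist $x\in X$ and $\delta>0$ such that $\overline{\mathrm{dens}}(\{n\in\mathbb{N}: d(T^nx,\mathbf{0})>\delta\})>0$.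
   Context: $\mathbb{N}$ is the set of positive integers and $\mathbf 0$ is the zero vector of $X$. For $A\subset\mathbb{N}$, $\overline{\mathrm{dens}}(A)=\limsup_{n\to\infty}\frac{\mathrm{card}(A\cap[1,n])}{n}$. A set is residual if it contains a dense $G_\delta$ subset. A Cantor set is a subset homeomorphic to the Cantor ternary set. A vector $x\in X$ is distributionally semi-irregular of type $2$ for $T$ if there exists $A\subset\mathbb{N}$ with $\overline{\mathrm{dens}}(A)=1$ such that $\lim_{A\ni n\to\infty}T^nx=\mathbf 0$ and there exists $B\subset\mathbb{N}$ with $\overline{\mathrm{dens}}(B)>0$ such that $\liminf_{B\ni n\to\infty}d(T^nx,\mathbf 0)>0$. For $m\in\mathbb{N}$, $x$ is distributionally $m$-irregular of type $2$ if there exists $A\subset\mathbb{N}$ with $\overline{\mathrm{dens}}(A)=1$ such that $\lim_{A\ni n\to\infty}T^nx=\mathbf 0$ and there exists $B\subset\mathbb{N}$ with $\overline{\mathrm{dens}}(B)>0$ such that $\lim_{B\ni n\to\infty}p_m(T^nx)=\infty$. A pair $(x,y)\in X\times X$ is distributionally proximal if for every $\varepsilon>0$, $\overline{\mathrm{dens}}(\{n\in\mathbb{N}:d(T^nx,T^ny)<\varepsilon\})=1$; the distributionally proximal relation is the set of all such pairs; the distributionally proximal cell of $\mathbf 0$ is the set of $y\in X$ such that $(\mathbf 0,y)$ is distributionally proximal. For $m\in\mathbb{N}$ and $\delta>0$, a pair $(x,y)$ is distributionally $m$-extremely $\delta$-chaotic of type $2$ if it is distributionally proximal and for any $M>0$,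 $\overline{\mathrm{dens}}(\{n\in\mathbb{N}:p_m(T^nx-T^ny)>M\})\ge\delta$. A set $K\subset X$ is distributionally $m$-extremely $\delta$-scrambled of type $2$ if any two distinct points of $K$ form such a pair. $T$ is mean-L-unstable if there exists $\delta>0$ such that for every $x\in X$ and $\varepsilon>0$ there exists $y\in X$ with $d(x,y)<\varepsilon$ such that $\overline{\mathrm{dens}}(\{n\in\mathbb{N}: d(T^nx,T^ny)>\delta\})\ge\delta$. *)

(* Defs.v *)
From HB Require Import structures.
From mathcomp Require Import all_boot all_order all_algebra.
From mathcomp Require Import complex.
From mathcomp Require Import all_classical all_reals all_analysis borel_hierarchy.

Set Implicit Arguments.
Unset Strict Implicit.
Unset Printing Implicit Defensive.

Import Order.TTheory GRing.Theory Num.Theory.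
Import numFieldNormedType.Exports.

Local Open Scope classical_set_scope.
Local Open Scope ring_scope.

(* Sequences indexed by the positive integers in the mathematics, such as
   (p_j), (O_j) and (K_j), are indexed here by [nat]: the term of index [j]
   stands for the one of index j + 1. Sets of times n, on the other hand, are
   not shifted: they are sets [A : set nat] whose possible element 0 affects
   neither densities nor limits along [A]. *)

Section Density.
Context {R : realType}.

Definition upper_density (A : set nat) : R :=
  limn_sup (fun n => (\sum_(1 <= i < n.+1 | i \in A) 1)%N%:R / n%:R : R).

(* The numbers that have a ternary expansion with digits 0 and 2 only. *)
Definition cantor_ternary : set R :=
  [set x | exists b : nat -> bool,
    series (fun j => (if b j then 2 else 0) / 3 ^+ j.+1) @ \oo --> x].

End Density.

Definition homeomorphic_sets (S T : topologicalType) (A : set S) (B : set T) :=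
  exists (f : S -> T) (g : T -> S),
    [/\ set_fun A B f, set_fun B A g,
        {in A, cancel f g} /\ {in B, cancel g f},
        {within A, continuous f} & {within B, continuous g}].

Definition cantor_set (R : realType) (S : topologicalType) (K : set S) :=
  homeomorphic_sets (@cantor_ternary R) K.

Definition residual (S : topologicalType) (A : set S) :=
  exists2 G : set S, Gdelta G /\ dense G & G `<=` A.

Variant scalar_field := RealScalars | ComplexScalars.

Definition scalars (R : realType) (k : scalar_field) : numFieldType :=
  match k with RealScalars => R | ComplexScalars => R[i] end.

(* The absolute value of a scalar, as an element of [R]: the library's norm
   of R[i] takes its values in R[i]. *)
Definition modulus (R : realType) (k : scalar_field) : scalars R k -> R :=
  match k with
  | RealScalars => fun a : R => `|a|
  | ComplexScalars => fun a : R[i] => Normc.normc a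
  end.

Definition infinite_dimensional (K : numFieldType) (X : lmodType K) :=
  ~ exists (n : nat) (e : 'I_n -> X),
      forall x, exists c : 'I_n -> K, x = \sum_(i < n) c i *: e i.

Definition seminorm (R : realType) (k : scalar_field)
    (X : lmodType (scalars R k)) (q : X -> R) :=
  [/\ forall x, 0 <= q x,
      forall x y, q (x + y) <= q x + q y &
      forall a x, q (a *: x) = modulus a * q x].

Section Dynamics.
Context {R : realType} {K : numFieldType} {X : tvsType K}.
Variable p : nat -> X -> R.

Definition separating := forall x, (forall j, p j x = 0) -> x = 0.

Definition increasing_seminorms := forall j x, p j x <= p j.+1 x.

Definition induces_topology := forall (x : X) (U : set X),
  nbhs x U <-> exists n (e : R),
    0 < e /\ [set y | forall j, (j <= n)%N -> p j (y - x) < e] `<=` U.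

Definition dist (x y : X) : R :=
  limn (series (fun j => 2^-1 ^+ j.+1 * Num.min 1 (p j (x - y)))).

(* The uniformity carried by a [tvsType] is only required to induce the
   topology, so completeness is expressed with the metric. *)
Definition complete_dist := forall u : nat -> X,
  (forall e : R, 0 < e -> exists N : nat, forall m n : nat,
     (N <= m)%N -> (N <= n)%N -> dist (u m) (u n) < e) ->
  exists l : X, u @ \oo --> l.

Variable T : X -> X.

Definition semi_irregular2 (x : X) :=
  (exists A : set nat, upper_density A = 1 :> R /\
     iter n T x @[n --> within A \oo] --> (0 : X)) /\
  (exists B : set nat, 0 < upper_density B :> R /\
     (0%E < limf_einf (fun n => (dist (iter n T x) 0)%:E) (within B \oo))%E).

Definition irregular2 (m : nat) (x : X) :=
  (exists A : set nat, upper_density A = 1 :> R /\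
     iter n T x @[n --> within A \oo] --> (0 : X)) /\
  (exists B : set nat, 0 < upper_density B :> R /\
     p m (iter n T x) @[n --> within B \oo] --> +oo).

Definition dist_proximal (x y : X) := forall e : R, 0 < e ->
  upper_density [set n | dist (iter n T x) (iter n T y) < e] = 1 :> R.

Definition proximal_relation : set (X * X) :=
  [set xy | dist_proximal xy.1 xy.2].

Definition proximal_cell0 : set X := [set y | dist_proximal 0 y].

Definition extremely_chaotic2 (m : nat) (delta : R) (x y : X) :=
  dist_proximal x y /\
  forall M : R, 0 < M ->
    delta <= upper_density [set n | M < p m (iter n T x - iter n T y)].

Definition extremely_scrambled2 (m : nat) (delta : R) (K : set X) :=
  forall x y, K x -> K y -> x <> y -> extremely_chaotic2 m delta x y.

Definition mean_L_unstable := exists2 delta : R, 0 < delta &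
  forall (x : X) (e : R), 0 < e -> exists2 y : X, dist x y < e &
    delta <= upper_density [set n | delta < dist (iter n T x) (iter n T y)].

End Dynamics.

(* Main.v *)
Require Import Defs.
From HB Require Import structures.
From mathcomp Require Import all_boot all_order all_algebra.
From mathcomp Require Import complex.
From mathcomp Require Import all_classical all_reals all_analysis.
From mathcomp Require Import zify ring lra.
Import Order.TTheory GRing.Theory Num.Theory.
Import numFieldNormedType.Exports.
Local Open Scope classical_set_scope.
Local Open Scope ring_scope.

(** All the conditions are compared with the last one, which concerns the orbit
of a single vector [x] and the density of the proximal cell of [0]. That each of
the others implies it is elementary, apart from the density of a residual set,
which is Baire's theorem. The converse has three steps.

Small unstable vectors ([unstable_at0]). A vector [y] of the proximal cell close
to [x] splits [x] as [(x - y) + y], and one of the two summands is often far from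
[0]. The first is small. The orbit of the second comes close to [0], and from
there on it is the orbit of a small vector. In both cases there are arbitrarily
small vectors whose orbits leave a fixed ball with a fixed upper density.

Amplification ([dense_frequently_beyond]). By linearity, large multiples of very
small unstable vectors are small vectors whose orbits exceed any given bound of
one seminorm, still with the same upper density. Adding them to an arbitrary
vector shows that the vectors whose orbit exceeds the bound with half of this
density are dense. Together with the density of the proximal cell this makes the
open sets [irregular_approx] dense.

Category. By Baire's theorem the intersection of these sets is residual, and
[density_pick] extracts from the density statements the sets of times that
irregularity asks for. Applied to differences, the same open sets drive the
construction of Cantor sets with prescribed generic differences ([Mycielski]):
[x] and [y] are scrambled as soon as [x - y] is in all the sets from some
index on. *)

Set Implicit Arguments.
Unset Strict Implicit.

(** * Upper density *)

Lemma half_le_of_le_sum (R : realFieldType) (a b d : R) :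
  d <= a + b -> d / 2 <= a \/ d / 2 <= b.
Proof. by move=> ab; case: (leP (d / 2) a) => h; [left|right; lra]. Qed.

Section UpperDensity.
Context {R : realType}.
Implicit Types (A B : set nat) (c : R).

Definition hits A n := (\sum_(1 <= i < n.+1 | i \in A) 1)%N.

(** This is the form in which upper densities are used throughout: up to an
arbitrarily small loss in [c], it is the inequality [c <= upper_density A], and
each single instance of it constrains finitely many times only. *)
Definition often c A :=
  forall N, exists2 n, (N <= n)%N & c * n%:R < (hits A n)%:R.

Lemma hitsS A n : hits A n.+1 = (hits A n + (n.+1 \in A))%N.
Proof. by rewrite /hits big_mkcond big_nat_recr//= -big_mkcond; case: ifP. Qed.

Lemma hits0 A : hits A 0 = 0%N.
Proof. by rewrite /hits big_geq. Qed.

Lemma hits_le A n : (hits A n <= n)%N.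
Proof. by elim: n => [|n IH]; rewrite ?hits0// hitsS; case: (_ \in _); lia. Qed.

Lemma hits_sub N A B n : (forall i, (N < i <= n)%N -> A i -> B i) ->
  (hits A n <= hits B n + N)%N.
Proof.
elim: n => [|n IH] AB; first by rewrite !hits0.
have {IH} := IH (fun i iN => AB i ltac:(lia)); rewrite !hitsS.
case: (leqP N n) => Nn; last by have := hits_le A n; case: (_ \in A); lia.
case: (boolP (_ \in A)) => [/set_mem /AB ABn|]; last by lia.
by rewrite (mem_set (ABn _)) ?Nn ?leqnn//; lia.
Qed.

Lemma hitsU A B n : (hits (A `|` B) n <= hits A n + hits B n)%N.
Proof.
elim: n => [|n IH]; rewrite ?hits0// !hitsS in_setU.
by move: IH; do 2!case: (_ \in _) => /=; lia.
Qed.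

Lemma hitsT n : hits setT n = n.
Proof. by elim: n => [|n IH]; rewrite ?hits0// hitsS in_setT IH addn1. Qed.

Lemma hits_gt0 A n : (0 < hits A n)%N -> exists i, A i.
Proof.
elim: n => [|n IH]; first by rewrite hits0.
by rewrite hitsS; case: (boolP (_ \in A)) => [/set_mem|_]; [exists n.+1|rewrite addn0].
Qed.

Lemma hits_shift A N n : (hits A (n + N) <= hits [set i | A (i + N)%N] n + N)%N.
Proof.
elim: n => [|n IH]; first by rewrite add0n hits0 hits_le.
rewrite addSn !hitsS.
have -> : ((n + N).+1 \in A) = (n.+1 \in [set i | A (i + N)%N]).
  by apply/idP/idP => /set_mem h; apply: mem_set; move: h; rewrite /= addSn.
lia.
Qed.

Let freq A n : R := (hits A n)%:R / n%:R.

Let freq_bounds A n : 0 <= freq A n <= 1.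
Proof.
rewrite /freq divr_ge0//=; case: n => [|n]; first by rewrite invr0 mulr0.
by rewrite ler_pdivrMr// mul1r ler_nat hits_le.
Qed.

Let freq_bounded A : bounded_fun (freq A : R^o^nat).
Proof.
exists 1; split=> // x x1 n _ /=; have /andP[f0 f1] := freq_bounds A n.
by rewrite ger0_norm//; apply: le_trans f1 (ltW x1).
Qed.

Let freq_ub A n : has_ubound (sdrop (freq A) n).
Proof. by exists 1 => _ [m _ <-]; case/andP: (freq_bounds A m). Qed.

Let upper_densityE A : upper_density A = inf (range (sups (freq A))).
Proof. exact: (@limn_supE _ (freq A)). Qed.

Let sups_lb A : has_lbound (range (sups (freq A))).
Proof.
exists 0 => _ [n _ <-]; have /andP[f0 _] := freq_bounds A n.
by apply: le_trans f0 (ub_le_sup _ _) => //; exists n => /=.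
Qed.

Lemma often_of_density c A : c < upper_density A -> often c A.
Proof.
rewrite upper_densityE => cA N.
(* the shift to [N.+1] discards the frequency [0 / 0] at time [0] *)
have : c < sup (sdrop (freq A) N.+1).
  by apply: lt_le_trans cA (ge_inf (sups_lb A) _); exists N.+1.
move=> /sup_gt[]; first by exists (freq A N.+1); exists N.+1 => /=.
move=> _ [n /= Nn <-]; rewrite /freq => h; exists n; first exact: ltnW.
by rewrite -ltr_pdivlMr// ltr0n; lia.
Qed.

Lemma density_of_often c A : often c A -> c <= upper_density A.
Proof.
move=> oA; rewrite upper_densityE; apply: lb_le_inf.
  by exists (sups (freq A) 0%N); exists 0%N.
move=> _ [N _ <-]; have [n Nn cn] := oA N.
apply: (@le_trans _ _ (freq A n)); last first.
  by apply: ub_le_sup => //; exists n.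
case: n Nn cn => [|n] Nn cn; first by rewrite mulr0 hits0 ltxx in cn.
by rewrite /freq ler_pdivlMr// ltW.
Qed.

Lemma density_le1 A : upper_density A <= 1 :> R.
Proof.
apply/ler_addgt0Pr => e e0; rewrite leNgt; apply/negP => /often_of_density.
move=> /(_ 0%N)[n _]; apply/negP; rewrite -leNgt.
have : (hits A n)%:R <= n%:R :> R by rewrite ler_nat hits_le.
by have : 0 <= n%:R :> R by []; nra.
Qed.

Lemma density_ge c A : (forall c', c' < c -> often c' A) -> c <= upper_density A.
Proof.
move=> h; apply/ler_addgt0Pr => e e0; rewrite -lerBlDr; apply: density_of_often.
by apply: h; rewrite ltrBlDr ltrDl.
Qed.

(** A bounded number of lost hits does not lower the upper density: for every
[c' < c] the slack [(c - c') * n] eventually exceeds [k]. *)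
Lemma density_of_hits k c A B :
  (forall N, exists2 n, (N <= n)%N & c * n%:R <= (hits B n)%:R) ->
  (forall n, (hits B n <= hits A n + k)%N) -> c <= upper_density A.
Proof.
move=> oB BA; apply: density_ge => c' cc' N.
have [M hM] : exists M : nat, k%:R / (c - c') < M%:R :> R.
  by exists (Num.truncn (k%:R / (c - c'))).+1; exact: truncnS_gt.
have [n Nn h] := oB (maxn N M).
exists n; first by move: Nn; rewrite geq_max => /andP[].
have Mn : M%:R <= n%:R :> R by rewrite ler_nat (leq_trans (leq_maxr _ _) Nn).
have : (hits B n)%:R <= (hits A n)%:R + k%:R :> R.
  by rewrite -natrD ler_nat.
have := lt_le_trans hM Mn; rewrite ltr_pdivrMr ?subr_gt0//; lra.
Qed.

Lemma density_eventually N A B : (forall n, (N <= n)%N -> A n -> B n) ->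
  upper_density A <= upper_density B :> R.
Proof.
move=> AB; apply/ler_addgt0Pr => e e0; rewrite -lerBlDr.
apply: (@density_of_hits N _ _ A) => [M|n].
  have [|n Mn h] := @often_of_density (upper_density A - e) A _ M.
    by rewrite ltrBlDr ltrDl.
  by exists n => //; exact: ltW.
by apply: hits_sub => i /andP[/ltnW Ni _]; exact: AB.
Qed.

Lemma density_sub A B : A `<=` B -> upper_density A <= upper_density B :> R.
Proof. by move=> AB; apply: (@density_eventually 0%N) => n _; exact: AB. Qed.

Lemma density_eq1 A : 1 <= upper_density A :> R -> upper_density A = 1 :> R.
Proof. by move=> h; apply/eqP; rewrite eq_le h density_le1. Qed.

Lemma density_setT : upper_density setT = 1 :> R.
Proof.
apply: density_eq1; apply: (@density_of_hits 0 _ _ setT) => [N|n].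
  by exists N => //; rewrite hitsT mul1r.
by rewrite addn0.
Qed.

(** Passing from a point to its [N]-th iterate does not lose density. *)
Lemma density_shift A N :
  upper_density A <= upper_density [set i | A (i + N)%N] :> R.
Proof.
apply/ler_addgt0Pr => e e0; rewrite -lerBlDr.
apply: (@density_of_hits (N + N) _ _ A) => [M|n].
  have [|n Mn h] := @often_of_density (upper_density A - e) A _ M.
    by rewrite ltrBlDr ltrDl.
  by exists n => //; exact: ltW.
have : (hits A n <= hits A (n + N))%N.
  elim: N => [|k IH]; first by rewrite addn0.
  by rewrite addnS hitsS (leq_trans IH)// leq_addr.
have := hits_shift A N n; lia.
Qed.

(** Pigeonhole at a common time: if both sets were rare from some time on, so
would be their union. *)
Lemma often_setU c c' A B : often (c + c') (A `|` B) -> often c A \/ often c' B.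
Proof.
move=> oAB; apply: contrapT => /not_orP[].
move=> /existsNP[N1 /forall2NP h1] /existsNP[N2 /forall2NP h2].
have [n Nn h] := oAB (maxn N1 N2); move: Nn; rewrite geq_max => /andP[n1 n2].
have [|/negP] := h1 n => //; rewrite -leNgt => {}h1.
have [|/negP] := h2 n => //; rewrite -leNgt => {}h2.
have : (hits (A `|` B) n)%:R <= (hits A n)%:R + (hits B n)%:R :> R.
  by rewrite -natrD ler_nat hitsU.
lra.
Qed.

Lemma densityU A B :
  upper_density (A `|` B) <= upper_density A + upper_density B :> R.
Proof.
apply/ler_addgt0Pr => e e0; rewrite leNgt; apply/negP => /often_of_density.
have -> : upper_density A + upper_density B + e =
  (upper_density A + e / 2) + (upper_density B + e / 2) :> R by field.
by move=> /often_setU[] /density_of_often; lra.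
Qed.

(** Diagonal choice of a set of times. With times [N k] growing so fast that
the first [N k] hits are negligible at time [N k.+1], it suffices to ask of a
time beyond [N k] that it lie in [S k]: between [N k] and [N k.+1] all the times
of [S k] qualify, because the sets [S k] decrease. *)
Lemma density_pick c (S : nat -> set nat) :
  (forall k, S k.+1 `<=` S k) -> (forall k, c <= upper_density (S k)) ->
  exists A, c <= upper_density A /\
    forall k, exists N, forall n, (N < n)%N -> A n -> S k n.
Proof.
move=> Sdec cS.
have aux (c' n i m a b : R) : (c - i) * n < b -> m <= i * n ->
    i * n <= (c - c') / 2 * n -> b <= a + m -> c' * n < a.
  by lra.
have Smono j k : (j <= k)%N -> S k `<=` S j.
  move/subnK => <-; elim: (k - j)%N => // i IH.
  by rewrite addSn; exact: subset_trans (Sdec _) IH.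
have /choice[f f_spec] : forall kN : nat * nat, exists n : nat,
    [/\ (kN.2 < n)%N, (kN.1.+1 * kN.2 <= n)%N &
      (c - kN.1.+1%:R^-1) * n%:R < (hits (S kN.1) n)%:R].
  move=> [k N] /=.
  have [|n Nn h] := @often_of_density (c - k.+1%:R^-1) (S k) _
                      (maxn N.+1 (k.+1 * N)).
    by apply: lt_le_trans (cS k); rewrite ltrBlDr ltrDl invr_gt0.
  by exists n; split => //; move: Nn; rewrite geq_max => /andP[].
pose fix N k := if k is k'.+1 then f (k', N k') else 0%N.
have Nlt k : (N k < N k.+1)%N by have [] := f_spec (k, N k).
have Nmono : {homo N : i j / (i <= j)%N}.
  by apply: homo_leq => // [? ? ?|k]; [exact: leq_trans|exact: ltnW (Nlt k)].
have Nge k : (k <= N k)%N.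
  by elim: k => // k IH; exact: leq_ltn_trans IH (Nlt k).
exists [set i | forall k, (N k < i)%N -> S k i]; split; last first.
  by move=> k; exists (N k) => n Nn /(_ k Nn).
apply: density_ge => c' cc' M.
have [K hK] : exists K : nat, 2 / (c - c') < K%:R :> R.
  by exists (Num.truncn (2 / (c - c'))).+1; exact: truncnS_gt.
pose k := maxn M K; exists (N k.+1).
  by rewrite (leq_trans _ (Nge _))// leqW// leq_maxl.
have [_ kN h] : [/\ (N k < N k.+1)%N, (k.+1 * N k <= N k.+1)%N &
  (c - k.+1%:R^-1) * (N k.+1)%:R < (hits (S k) (N k.+1))%:R].
  exact: f_spec (k, N k).
have : (hits (S k) (N k.+1) <=
    hits [set i | forall k, (N k < i)%N -> S k i] (N k.+1) + N k)%N.
  apply: hits_sub => i /andP[ki ik] Ski j ji; apply: Smono Ski.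
  by rewrite leqNgt; apply/negP => /Nmono kj; lia.
rewrite -(ler_nat R) natrD.
have {}kN : (N k)%:R <= k.+1%:R^-1 * (N k.+1)%:R :> R.
  by rewrite ler_pdivlMl// -natrM ler_nat.
have k1 : k.+1%:R^-1 <= (c - c') / 2.
  rewrite invf_ple ?posrE ?divr_gt0 ?subr_gt0// invf_div (le_trans (ltW hK))//.
  by rewrite ler_nat leqW// leq_maxr.
have : k.+1%:R^-1 * (N k.+1)%:R <= (c - c') / 2 * (N k.+1)%:R.
  by rewrite ler_wpM2r.
move: h kN; exact: aux.
Qed.

End UpperDensity.

(** * The F-norm of a Frechet space *)

Lemma exists_half_pow_lt (R : realType) (e : R) :
  0 < e -> exists n, 2^-1 ^+ n.+1 < e.
Proof.
move=> e0; have := near_infty_natSinv_expn_lt (PosNum e0).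
move=> [n _ /(_ n.+1 (leqnSn n))] /=; rewrite div1r -exprVn => ?.
by exists n.
Qed.

Section FrechetNorm.
Context {R : realType} {k : scalar_field} {X : tvsType (scalars R k)}.
Context {p : nat -> X -> R}.
Context (p_seminorm : forall j, seminorm (p j)).
Context (p_increasing : increasing_seminorms p) (p_topology : induces_topology p).
Implicit Types (x y : X) (e : R).

Lemma modulusN1 : modulus (-1 : scalars R k) = 1.
Proof. case: k => /=; first exact: normrN1.
exact: etrans (normcN (1 : Rcomplex R)) (Normc.normc1 R). Qed.

Lemma modulus_nat n : modulus (n%:R : scalars R k) = n%:R.
Proof.
case: k => /=; first by rewrite normr_nat.
apply: etrans (normcMn (1 : Rcomplex R) n) _.
by rewrite (Normc.normc1 R).
Qed.

Lemma seminorm_ge0 j x : 0 <= p j x.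
Proof. by case: (p_seminorm j). Qed.

Lemma seminormD j x y : p j (x + y) <= p j x + p j y.
Proof. by case: (p_seminorm j). Qed.

Lemma seminormN j x : p j (- x) = p j x.
Proof.
by case: (p_seminorm j) => _ _ /(_ (-1) x); rewrite scaleN1r modulusN1 mul1r.
Qed.

Lemma seminormMn j x n : p j (x *+ n) = n%:R * p j x.
Proof.
by case: (p_seminorm j) => _ _ /(_ n%:R x); rewrite scaler_nat modulus_nat.
Qed.

Lemma seminorm0 j : p j 0 = 0.
Proof. by have := seminormMn j 0 0; rewrite mulr0n mul0r. Qed.

Lemma seminorm_mono i j x : (i <= j)%N -> p i x <= p j x.
Proof.
move/subnK => <-; elim: (j - i)%N => // n IH.
by rewrite addSn (le_trans IH).
Qed.

(** [dist] is translation invariant, so it is the distance of the F-norm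
[fnorm], which is subadditive and even but not homogeneous. *)
Definition fnorm x : R := dist p x 0.

Let term x j : R := 2^-1 ^+ j.+1 * Num.min 1 (p j x).

Let fnormE x : fnorm x = limn (series (term x)).
Proof. by rewrite /fnorm /dist subr0. Qed.

Lemma distE x y : dist p x y = fnorm (x - y).
Proof. by rewrite fnormE. Qed.

Let term_ge0 x j : 0 <= term x j.
Proof. by rewrite mulr_ge0 ?exprn_ge0 ?invr_ge0// le_min ler01 seminorm_ge0. Qed.

Let partial_nd x : nondecreasing_seq (series (term x)).
Proof. by apply: nondecreasing_series => n _ _; exact: term_ge0. Qed.

Let partial_add x j n :
  series (term x) (j + n)%N <= series (term x) j + 2^-1 ^+ j * (1 - 2^-1 ^+ n).
Proof.
elim: n => [|n IH]; first by rewrite addn0 expr0 subrr mulr0 addr0.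
have termle : term x (j + n) <= 2^-1 ^+ (j + n).+1.
  apply: ler_piMr; first by rewrite exprn_ge0// invr_ge0.
  by rewrite ge_min lexx.
rewrite addnS seriesSr; apply: le_trans (lerD IH termle) _.
rewrite -addrA lerD2l -addnS exprD !exprS.
have : 0 <= 2^-1 ^+ j :> R by rewrite exprn_ge0// invr_ge0.
have : 0 <= 2^-1 ^+ n :> R by rewrite exprn_ge0// invr_ge0.
nra.
Qed.

Let partial_le x j n : series (term x) n <= series (term x) j + 2^-1 ^+ j.
Proof.
rewrite (le_trans (partial_nd x (leq_addl j n)))// (le_trans (partial_add _ _ _))//.
rewrite lerD2l ler_piMr ?exprn_ge0 ?invr_ge0// gerBl exprn_ge0//.
Qed.

Let partial_cvg x : cvgn (series (term x)).
Proof.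
apply: nondecreasing_is_cvgn; first exact: partial_nd.
by exists (series (term x) 0%N + 2^-1 ^+ 0) => _ [n _ <-]; exact: partial_le.
Qed.

Let partial_fnorm x n : series (term x) n <= fnorm x.
Proof. by rewrite fnormE; apply: nondecreasing_cvgn_le. Qed.

Let fnorm_le x (a : R) : (forall n, series (term x) n <= a) -> fnorm x <= a.
Proof. by move=> h; rewrite fnormE; apply: limr_le => //; exact: nearW. Qed.

Lemma fnorm_ge0 x : 0 <= fnorm x.
Proof. by apply: le_trans (partial_fnorm x 0); rewrite /series/= big_geq. Qed.

Lemma fnormN x : fnorm (- x) = fnorm x.
Proof.
rewrite !fnormE; congr (limn (series _)); apply/funext => j.
by rewrite /term seminormN.
Qed.

Lemma fnormBC x y : fnorm (x - y) = fnorm (y - x).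
Proof. by rewrite -fnormN opprB. Qed.

Lemma fnorm0 : fnorm 0 = 0.
Proof.
apply/le_anti; rewrite fnorm_ge0 andbT; apply: fnorm_le => n.
rewrite /series/= big1// => j _.
by rewrite /term seminorm0 (min_idPr _) ?ler01// mulr0.
Qed.

Lemma fnormD x y : fnorm (x + y) <= fnorm x + fnorm y.
Proof.
apply: fnorm_le => n; apply: le_trans (lerD (partial_fnorm x n) (partial_fnorm y n)).
rewrite /series/= -big_split/=; apply: ler_sum => j _.
rewrite /term -mulrDr ler_wpM2l ?exprn_ge0 ?invr_ge0//.
have := seminormD j x y; have := seminorm_ge0 j x; have := seminorm_ge0 j y.
rewrite /Num.min; do 3!case: ltP => ? /=; lra.
Qed.

Lemma fnormMn x n : fnorm (x *+ n) <= n%:R * fnorm x.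
Proof.
elim: n => [|n IH]; first by rewrite mulr0n mul0r fnorm0.
by rewrite mulrS (le_trans (fnormD _ _))// -natr1 mulrDl mul1r addrC lerD2r.
Qed.

(** Together with [fnorm_le_of_seminorm], this compares the F-norm with one
seminorm at a time: the truncated term of index [j] is a lower bound, and the
terms beyond [j] contribute at most [2^-1 ^+ j.+1] to an upper bound. *)
Lemma seminorm_lt_of_fnorm j x e : e <= 1 ->
  fnorm x < 2^-1 ^+ j.+1 * e -> p j x < e.
Proof.
move=> e1 h; have : term x j <= fnorm x.
  apply: le_trans (partial_fnorm x j.+1); rewrite seriesSr lerDr.
  by rewrite /series/= sumr_ge0.
move/le_lt_trans/(_ h); rewrite /term ltr_pM2l ?exprn_gt0 ?invr_gt0//.
by rewrite gt_min; case/orP => //; lra.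
Qed.

Lemma fnorm_le_of_seminorm j x e : p j x <= e -> fnorm x <= e + 2^-1 ^+ j.+1.
Proof.
move=> pe; have e0 : 0 <= e by apply: le_trans pe; exact: seminorm_ge0.
apply: fnorm_le => n; rewrite (le_trans (partial_le x j.+1 n))// lerD2r.
have : forall i, (i <= j.+1)%N -> series (term x) i <= e * (1 - 2^-1 ^+ i).
  elim=> [|i IH] ij; first by rewrite /series/= big_geq// expr0 subrr mulr0.
  rewrite seriesSr; have {IH} := IH (ltnW ij).
  have : term x i <= 2^-1 ^+ i.+1 * e.
    rewrite /term ler_wpM2l ?exprn_ge0 ?invr_ge0// ge_min.
    by rewrite (le_trans (seminorm_mono x _) pe) ?orbT.
  by rewrite exprS; lra.
move=> /(_ j.+1 (leqnn _))/le_trans; apply.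
by rewrite ler_piMr// gerBl exprn_ge0// invr_ge0.
Qed.

Lemma nbhs_fnorm x (U : set X) :
  nbhs x U <-> exists2 e, 0 < e & forall y, fnorm (y - x) < e -> U y.
Proof.
rewrite p_topology; split=> [[n [e [e0 eU]]]|[e e0 eU]].
  exists (2^-1 ^+ n.+1 * Num.min 1 e).
    by rewrite mulr_gt0 ?exprn_gt0 ?invr_gt0// lt_min ltr01.
  move=> y h; apply: eU => j jn; apply: le_lt_trans (seminorm_mono _ jn) _.
  have /seminorm_lt_of_fnorm -/(_ _ _ h) : Num.min 1 e <= 1 by rewrite ge_min lexx.
  by rewrite lt_min => /andP[].
have [n ne] := exists_half_pow_lt (divr_gt0 e0 (ltr0Sn R 1)).
exists n, (e / 2); split=> [|y /(_ _ (leqnn n)) h]; first by rewrite divr_gt0.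
by apply: eU; have := fnorm_le_of_seminorm (ltW h); lra.
Qed.

End FrechetNorm.

(** * Baire's theorem and generic finite families *)

Section BaireMycielski.
Context {R : realType} {k : scalar_field} {X : tvsType (scalars R k)}.
Context {p : nat -> X -> R}.
Context (p_seminorm : forall j, seminorm (p j)).
Context (p_increasing : increasing_seminorms p) (p_topology : induces_topology p).
Context (X_complete : complete_dist p).
Implicit Types (x y u v : X) (r : R).

Local Notation N := (fnorm (p := p)).
Local Notation ball x r := [set u | N (u - x) < r].

Let nbhsP := nbhs_fnorm p_seminorm p_increasing p_topology.

Lemma open_fnormP (U : set X) :
  open U <-> forall x, U x -> exists2 r, 0 < r & ball x r `<=` U.
Proof.
rewrite openE; split=> Uo x /Uo; rewrite /interior nbhsP => -[r r0 h];
by exists r.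
Qed.

Lemma open_fnorm_ball x r : open (ball x r).
Proof.
apply/open_fnormP => y /= yx; exists (r - N (y - x)); first by rewrite subr_gt0.
move=> u /= uy; have := fnormD p_seminorm (u - y) (y - x).
by rewrite addrA subrK; lra.
Qed.

Lemma fnorm_ball_center x r : 0 < r -> ball x r x.
Proof. by move=> r0 /=; rewrite subrr (fnorm0 p_seminorm). Qed.

(** Halved radii and centers moving by at most a quarter of the radius keep the
sequence inside each of the previous open balls, and so does its limit. *)
Lemma shrinking_balls_limit (x : nat -> X) (r : nat -> R) :
  (forall n, 0 < r n) -> (forall n, r n.+1 <= r n / 2) ->
  (forall n, ball (x n) (r n / 4) (x n.+1)) ->
  exists l, forall n, ball (x n) (r n) l.
Proof.
move=> r0 rS xS.
have near_x m n : N (x (n + m)%N - x n) <= r n / 2.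
  elim: m n => [|m IH] n.
    by rewrite addn0 subrr (fnorm0 p_seminorm) divr_ge0// ltW.
  have := IH n.+1; rewrite addSnnS => h.
  have := fnormD p_seminorm (x (n + m.+1)%N - x n.+1) (x n.+1 - x n).
  rewrite addrA subrK; have := rS n; have := xS n => /=; lra.
have r_le n : r n <= r 0%N * 2^-1 ^+ n.
  elim: n => [|n IH]; first by rewrite expr0 mulr1.
  by have := rS n; rewrite exprS; lra.
have [|l xl] := X_complete (u := x).
  move=> e e0; have [n hn] := exists_half_pow_lt (divr_gt0 e0 (r0 0%N)).
  exists n.+1 => a b na nb; rewrite distE.
  have := near_x (a - n.+1)%N n.+1; have := near_x (b - n.+1)%N n.+1.
  rewrite !subnKC// (fnormBC p_seminorm (x b)) => hb ha.
  have := fnormD p_seminorm (x a - x n.+1) (x n.+1 - x b); rewrite addrA subrK.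
  have := r_le n.+1; move: hn; rewrite ltr_pdivlMr//.
  by lra.
exists l => n /=.
have : nbhs l (ball l (r n / 2)).
  by apply/nbhsP; exists (r n / 2); rewrite ?divr_gt0.
move=> /xl[M _ /(_ (n + M)%N (leq_addl _ _)) /=].
rewrite (fnormBC p_seminorm).
have := fnormD p_seminorm (l - x (n + M)%N) (x (n + M)%N - x n).
by rewrite addrA subrK; have := near_x M n; lra.
Qed.

Lemma dependent_sequence (T : Type) (s0 : T) (P : T -> Prop)
    (Q : nat -> T -> T -> Prop) :
  P s0 -> (forall n s, P s -> exists2 s', P s' & Q n s s') ->
  exists s : nat -> T, [/\ s 0%N = s0, forall n, P (s n) &
    forall n, Q n (s n) (s n.+1)].
Proof.
move=> P0 PQ.
have /choice[f fP] : forall ns : nat * T, exists s' : T,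
    P ns.2 -> P s' /\ Q ns.1 ns.2 s'.
  move=> [n s]; have [/(PQ n)[s' ? ?]|nP] := pselect (P s).
    by exists s'.
  by exists s => /= /nP.
pose fix s n := if n is n'.+1 then f (n', s n') else s0.
have Ps n : P (s n) by elim: n => //= n /(fP (n, s n))[].
by exists s; split=> // n; have [] := fP (n, s n) (Ps n).
Qed.

(** The usual proof with nested balls, for the translation-invariant metric of
a space which need not be normed. *)
Theorem frechet_Baire (G : nat -> set X) :
  (forall n, open (G n) /\ dense (G n)) -> dense (\bigcap_n G n).
Proof.
move=> God O [x0 Ox0] Oo.
have [r0 r0_gt0 r0O] := (open_fnormP _).1 Oo _ Ox0.
have [|n [x r] /= r_gt0|s [s0 sP sS]] := @dependent_sequence (X * R)%type (x0, r0)
    (fun s => 0 < s.2) (fun n s s' => [/\ s'.2 <= s.2 / 2,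
       ball s.1 (s.2 / 4) s'.1 & ball s'.1 s'.2 `<=` G n]) => //=.
  have [Go Gd] := God n.
  have [|y [By Gy]] := Gd (ball x (r / 4)) _ (open_fnorm_ball _ _).
    by exists x; apply: fnorm_ball_center; rewrite divr_gt0.
  have [r' r'0 r'G] := (open_fnormP _).1 Go _ Gy.
  exists (y, Num.min r' (r / 2)) => /=.
    by rewrite lt_min r'0 divr_gt0.
  split=> //; first by rewrite ge_min lexx orbT.
  by move=> u /=; rewrite lt_min => /andP[/r'G].
have [|||l lP] := @shrinking_balls_limit (fun n => (s n).1) (fun n => (s n).2).
- by [].
- by move=> n; have [] := sS n.
- by move=> n; have [] := sS n.
exists l; split; first by apply: r0O; have := lP 0%N; rewrite s0.
by move=> n _; have [_ _] := sS n; apply.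
Qed.

Lemma generic_point (G : set X) (s : seq X) (W : set X) :
  open G -> dense G -> open W -> W !=set0 ->
  exists2 y, W y & forall a, a \in s -> G (y - a).
Proof.
move=> Go Gd; elim: s W => [|a s IH] W Wo [w Ww]; first by exists w.
have [y [Wy Gy]] : [set y | W (y + a)] `&` G !=set0.
  apply: Gd; first by exists (w - a); rewrite /= subrK.
  apply/open_fnormP => x /((open_fnormP _).1 Wo)[r r0 h]; exists r => // u ux.
  by apply: h => /=; rewrite opprD addrACA subrr addr0.
have [||z [Wz Gz] zs] := IH (W `&` [set z | G (z - a)]).
- apply: openI => //.
  apply/open_fnormP => x /((open_fnormP _).1 Go)[r r0 h]; exists r => // u ux.
  by apply: h => /=; rewrite opprB addrA subrK.
- by exists (y + a); split => //=; rewrite addrK.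
by exists z => // b; rewrite inE => /predU1P[->|/zs].
Qed.

(** Choosing the points one after the other, each new one only has to avoid
finitely many translates of the complement of [G]; evenness of [G] takes care of
the differences taken in the other order. *)
Lemma generic_family (I : eqType) (L : seq I) (W : I -> set X) (G : set X) :
  open G -> dense G -> (forall u, G u -> G (- u)) ->
  (forall i, open (W i) /\ W i !=set0) ->
  exists x : I -> X, forall i, i \in L ->
    W i (x i) /\ forall j, j \in L -> i != j -> G (x i - x j).
Proof.
move=> Go Gd Gsym Wo; elim: L => [|i L [x xP]]; first by exists (fun=> 0).
have [iL|iL] := boolP (i \in L).
  exists x => j; rewrite inE => /predU1P jL.
  have /xP[Wj jG] : j \in L by case: jL => [->|].
  split=> // l; rewrite inE => /predU1P lL; apply: jG.
  by case: lL => [->|].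
have [y Wy yG] := generic_point (map x L) Go Gd (Wo i).1 (Wo i).2.
exists (fun j => if j == i then y else x j) => j.
have [->{j} _|ji] := eqVneq j i.
  split=> // j; rewrite inE eq_sym; case: (eqVneq j i) => //= _ jL _.
  by apply: yG; exact: map_f.
rewrite inE (negPf ji) /= => jL; have [Wj jG] := xP _ jL; split=> // l.
rewrite inE; case: (eqVneq l i) => [-> _ _|li /=]; last exact: jG.
by rewrite -opprB; exact/Gsym/yG/map_f.
Qed.

End BaireMycielski.

(** * Recognizing Cantor sets *)

Section CantorCriterion.
Context {R : realType}.
Implicit Types (b : nat -> bool) (n : nat).

Definition agree n b b' := forall i, (i < n)%N -> b i = b' i.

Let digit b j : R := (if b j then 2 else 0) / 3 ^+ j.+1.

Definition ternary b : R := limn (series (digit b)).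

Let digit_ge0 b j : 0 <= digit b j.
Proof. by rewrite /digit divr_ge0 ?exprn_ge0//; case: ifP. Qed.

Let partial_le1 b n : series (digit b) n <= 1 - 3^-1 ^+ n.
Proof.
elim: n => [|n IH]; first by rewrite /series/= big_geq// expr0 subrr.
rewrite seriesSr /digit; have : 0 <= 3^-1 ^+ n :> R by rewrite exprn_ge0// invr_ge0.
by rewrite -exprVn !exprS; case: (b n); lra.
Qed.

Let partial_cvg b : cvgn (series (digit b)).
Proof.
apply: nondecreasing_is_cvgn; first exact: nondecreasing_series.
exists 1 => _ [n _ <-]; apply: le_trans (partial_le1 _ _) _.
by rewrite gerBl exprn_ge0// invr_ge0.
Qed.

Lemma ternaryP b : series (digit b) @ \oo --> ternary b.
Proof. exact: partial_cvg. Qed.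

Lemma ternary_ge0 b : 0 <= ternary b.
Proof. by apply: limr_ge => //; apply: nearW => n; rewrite /series/= sumr_ge0. Qed.

Lemma ternary_le1 b : ternary b <= 1.
Proof.
apply: limr_le => //; apply: nearW => n; apply: le_trans (partial_le1 _ _) _.
by rewrite gerBl exprn_ge0// invr_ge0.
Qed.

(** Self-similarity of the ternary set, which turns the comparison of two
expansions into an induction on the number of common digits. *)
Lemma ternary_shift b :
  3 * ternary b = (if b 0%N then 2 else 0) + ternary (fun i => b i.+1).
Proof.
have h n : series (digit b) n.+1 =
    3^-1 * ((if b 0%N then 2 else 0) + series (digit (fun i => b i.+1)) n).
  rewrite /series/= big_nat_recl//= mulrDr mulr_sumr; congr (_ + _).
    by rewrite /digit expr1 mulrC.
  by apply: eq_bigr => i _; rewrite /digit [in LHS]exprS invfM mulrCA.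
have := @ternaryP b; rewrite -(cvg_shiftS (series (digit b))) => cb.
have cb' : [sequence series (digit b) n.+1]_n @ \oo -->
    3^-1 * ((if b 0%N then 2 else 0) + ternary (fun i => b i.+1)).
  rewrite (_ : mk_sequence _ = fun n =>
      3^-1 * ((if b 0%N then 2 else 0) + series (digit (fun i => b i.+1)) n)).
    apply: cvgM; first exact: cvg_cst.
    by apply: cvgD; [exact: cvg_cst|exact: ternaryP].
  by apply/funext => n /=; rewrite h.
by rewrite (cvg_unique _ cb cb')// mulrA divff// mul1r.
Qed.

Lemma ternary_close n b b' : agree n b b' ->
  `|ternary b - ternary b'| <= 3^-1 ^+ n.
Proof.
elim: n b b' => [|n IH] b b' bb'.
  rewrite expr0 ler_norml; have := ternary_ge0 b; have := ternary_ge0 b'.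
  by have := ternary_le1 b; have := ternary_le1 b'; lra.
have := IH _ _ (fun i => bb' i.+1 : (i < n)%N -> _); rewrite exprS.
have := ternary_shift b; have := ternary_shift b'; rewrite bb'//.
by rewrite !ler_norml; lra.
Qed.

Lemma ternary_agree n b b' : `|ternary b - ternary b'| < 3^-1 ^+ n ->
  agree n b b'.
Proof.
elim: n b b' => [//|n IH] b b'; rewrite exprS => h.
have sb := ternary_shift b; have sb' := ternary_shift b'.
have := ternary_ge0 (fun i => b i.+1); have := ternary_ge0 (fun i => b' i.+1).
have := ternary_le1 (fun i => b i.+1); have := ternary_le1 (fun i => b' i.+1).
have n1 : 3^-1 ^+ n <= 1 :> R by rewrite exprn_ile1 ?invr_ge0 ?invf_le1 ?ler1n.
move=> h1 h2 h3 h4.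
have b0 : b 0%N = b' 0%N.
  move: h sb sb'; rewrite ltr_norml.
  by case: (b 0%N); case: (b' 0%N) => //; lra.
move=> [//|i]; rewrite ltnS; apply: (IH (fun i => b i.+1) (fun i => b' i.+1)).
by move: h; rewrite b0 in sb; rewrite !ltr_norml; lra.
Qed.

Lemma cantor_ternaryP x : @cantor_ternary R x <-> exists b, x = ternary b.
Proof.
split=> -[b h]; exists b.
  by apply/esym/cvg_lim.
by rewrite h; exact: ternaryP.
Qed.

(** The hypotheses are continuity of [phi] and of its inverse, read on the
digits: two points of the ternary set are close exactly when many of their first
digits agree ([ternary_close], [ternary_agree]). *)
Theorem cantor_set_range (S : topologicalType) (phi : (nat -> bool) -> S) :
  (forall b U, nbhs (phi b) U ->
     exists n, forall b', agree n b b' -> U (phi b')) ->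
  (forall b n, exists2 U, nbhs (phi b) U &
     forall b', U (phi b') -> agree n b b') ->
  cantor_set R (range phi).
Proof.
move=> phi_cont phi_sep.
have phi_inj b b' : phi b = phi b' -> b = b'.
  move=> e; apply/funext => i; have [U Ub h] := phi_sep b i.+1.
  by apply: h => //; rewrite -e; exact: nbhs_singleton.
have ternary_inj b b' : ternary b = ternary b' -> b = b'.
  move=> e; apply/funext => i; apply: (@ternary_agree i.+1) => //.
  by rewrite e subrr normr0 exprn_gt0// invr_gt0.
have /choice[digits digitsP] : forall x, exists b, @cantor_ternary R x -> x = ternary b.
  move=> x; have [/cantor_ternaryP[b ->]|] := pselect (@cantor_ternary R x).
    by exists b.
  by exists xpredT.
have /choice[code codeP] : forall y, exists b, range phi y -> y = phi b.
  move=> y; have [[b _ <-]|] := pselect (range phi y); first by exists b.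
  by exists xpredT.
have digitsK b : digits (ternary b) = b.
  by apply: ternary_inj; rewrite -digitsP//; apply/cantor_ternaryP; exists b.
have codeK b : code (phi b) = b.
  by apply: phi_inj; rewrite -codeP//; exists b.
exists (fun x => phi (digits x)), (fun y => ternary (code y)); split.
- by move=> x _; exists (digits x).
- by move=> y _; apply/cantor_ternaryP; exists (code y).
- split=> [x /set_mem/cantor_ternaryP[b ->]|y /set_mem[b _ <-]].
    by rewrite codeK digitsK.
  by rewrite digitsK codeK.
- apply/subspace_continuousP => x /cantor_ternaryP[b ->].
  rewrite /from_subspace digitsK => U /phi_cont[n h].
  have n0 : 0 < 3^-1 ^+ n :> R by rewrite exprn_gt0// invr_gt0.
  apply/nbhs_ballP; exists (3^-1 ^+ n) => //= z bz /cantor_ternaryP[b' zb'].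
  by rewrite zb' digitsK; apply/h/ternary_agree; rewrite -zb'.
- apply/subspace_continuousP => y [b _ <-].
  rewrite /from_subspace codeK => U /nbhs_ballP[e /= e0 eU].
  have [n hn] : exists n, 3^-1 ^+ n < e.
    have [n hn] := exists_half_pow_lt e0; exists n.+1; apply: le_lt_trans hn.
    by rewrite lerXn2r ?nnegrE ?invr_ge0// lef_pV2 ?posrE ?ler_nat.
  have [V Vb h] := phi_sep b n; apply: filterS Vb => z Vz [b' _ zb'].
  apply: eU; rewrite /ball/= -zb' codeK; apply: le_lt_trans hn.
  by apply/ternary_close/h; rewrite zb'.
Qed.

Lemma cantor_set_two_points (S : topologicalType) (K : set S) :
  cantor_set R K -> exists x y, [/\ K x, K y & x <> y].
Proof.
move=> [f [g [fK _ [gf _] _ _]]].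
have tern b : @cantor_ternary R (ternary b) by apply/cantor_ternaryP; exists b.
exists (f (ternary xpred0)), (f (ternary xpredT)).
split; [exact: fK|exact: fK|move/(congr1 g)].
rewrite !gf ?inE// => e; have /(_ 0%N isT) // : agree 1 xpred0 xpredT.
by apply: ternary_agree; rewrite e subrr normr0 exprn_gt0// invr_gt0.
Qed.

End CantorCriterion.

(** * Cantor sets with generic differences *)

Section Mycielski.
Context {R : realType} {k : scalar_field} {X : tvsType (scalars R k)}.
Context {p : nat -> X -> R}.
Context (p_seminorm : forall j, seminorm (p j)).
Context (p_increasing : increasing_seminorms p) (p_topology : induces_topology p).
Context (X_complete : complete_dist p).
Implicit Types (x y u : X) (r : R) (b : nat -> bool).

Local Notation N := (fnorm (p := p)).
Local Notation ball x r := [set u | N (u - x) < r].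

Let nbhsP := nbhs_fnorm p_seminorm p_increasing p_topology.
Let openP := open_fnormP p_seminorm p_increasing p_topology.

Lemma uniform_radius (I : eqType) (L : seq I) (P : I -> R -> Prop) :
  (forall i r r', 0 < r' <= r -> P i r -> P i r') ->
  (forall i, i \in L -> exists2 r, 0 < r & P i r) ->
  exists2 r, 0 < r & forall i, i \in L -> P i r.
Proof.
move=> Pdown; elim: L => [|i L IH] PL; first by exists 1.
have [|r r0 rL] := IH.
  by move=> j jL; apply: PL; rewrite inE jL orbT.
have [|s s0 si] := PL i; first by rewrite inE eqxx.
have m0 : 0 < Num.min r s by rewrite lt_min r0.
exists (Num.min r s) => // j; rewrite inE => /predU1P[->|/rL jr].
  by apply: Pdown si; rewrite m0 ge_min lexx orbT.
by apply: Pdown jr; rewrite m0 ge_min lexx.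
Qed.

Lemma generic_balls (I : eqType) (L : seq I) (W : I -> set X) (G : set X) :
  open G -> dense G -> (forall u, G u -> G (- u)) ->
  (forall i, open (W i) /\ W i !=set0) ->
  exists (x : I -> X) (r : R), [/\ 0 < r,
    forall i, i \in L -> ball (x i) r `<=` W i &
    forall i j, i \in L -> j \in L -> i != j ->
      forall u v, ball (x i) r u -> ball (x j) r v -> G (u - v)].
Proof.
move=> Go Gd Gs Wo.
have [x xP] := generic_family p_seminorm p_increasing p_topology L Go Gd Gs Wo.
have [||r r0 rP] := @uniform_radius I L (fun i r => ball (x i) r `<=` W i).
- by move=> i r r' /andP[_ rr'] h u /= /lt_le_trans/(_ rr')/h.
- by move=> i /xP[Wi _]; exact: (openP _).1 (Wo i).1 _ Wi.
have [||s s0 sP] := @uniform_radius I L (fun i r => forall j, j \in L -> i != j ->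
      forall u v, ball (x i) r u -> ball (x j) r v -> G (u - v)).
- move=> i r1 r2 /andP[_ r12] h j jL ij u v /= ui vj.
  by apply: (h j) => //=; exact: lt_le_trans r12.
- move=> i /xP[_ iG]; apply: uniform_radius.
    move=> j r1 r2 /andP[_ r12] h ij u v /= ui vj.
    by apply: h => //=; exact: lt_le_trans r12.
  move=> j jL; have [->|ij] := eqVneq i j; first by exists 1; rewrite ?eqxx.
  have [e e0 eG] := (openP _).1 Go _ (iG j jL ij).
  exists (e / 2) => [|_ u v /= ui vj]; first by rewrite divr_gt0.
  have -> : u - v = (u - x i) - (v - x j) + (x i - x j).
    by rewrite addrACA subrK opprB addrAC subrr add0r.
  apply: eG => /=; rewrite addrK.
  have := fnormD p_seminorm (u - x i) (- (v - x j)).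
  by rewrite (fnormN p_seminorm); lra.
exists x, (Num.min r s); split.
- by rewrite lt_min r0.
- by move=> i /rP h u /=; rewrite lt_min => /andP[/h].
- move=> i j iL jL ij u v /=; rewrite !lt_min => /andP[_ ui] /andP[_ vj].
  exact: (sP i iL j jL ij).
Qed.

Context (G O : nat -> set X).
Context (G_open_dense : forall n, open (G n) /\ dense (G n)).
Context (G_opp : forall n u, G n u -> G n (- u)) (G_not0 : forall n, ~ G n 0).
Context (O_open : forall j, open (O j) /\ O j !=set0).

(** The nodes of the binary tree are reversed words, so that the children of
the node [w] are [false :: w] and [true :: w]. *)
Definition prefix_rev b n : seq bool := rev (mkseq b n).

Lemma prefix_revS b n : prefix_rev b n.+1 = b n :: prefix_rev b n.
Proof. by rewrite /prefix_rev mkseqS rev_rcons. Qed.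

Lemma size_prefix_rev b n : size (prefix_rev b n) = n.
Proof. by rewrite size_rev size_mkseq. Qed.

Lemma prefix_revP b b' n : agree n b b' <-> prefix_rev b n = prefix_rev b' n.
Proof.
elim: n => [|n IH]; first by split.
rewrite !prefix_revS; split=> [h|[bn /IH h] i].
  by rewrite (h n)// (IH.1 _)// => i ni; apply: h; exact: leqW.
by rewrite ltnS leq_eqVlt => /predU1P[->|/h].
Qed.

(** The Cantor sets of all indices grow in one binary tree: the set of index
[j] occupies the subtree above the word made of [j] ones and a zero. *)
Definition branch j b i :=
  if (i < j)%N then true else if i == j then false else b (i - j.+1)%N.

Let strings n : seq (seq bool) := map val (enum {: n.-tuple bool}).

Let mem_strings s : s \in strings (size s).
Proof. by apply/mapP; exists (in_tuple s); rewrite ?mem_enum. Qed.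

(* A state consists of the centers of the balls at all the nodes of a level, and
   of their common radius. The node that starts the [n]-th Cantor set is placed
   in [O n]; every other node stays in the ball of its parent. *)
Let next n (s s' : (seq bool -> X) * R) := [/\ s'.2 <= s.2 / 2,
  forall c w, size w = n -> ball (s'.1 (c :: w)) s'.2 `<=`
    (if c :: w == false :: nseq n true then O n else ball (s.1 w) (s.2 / 4)) &
  forall v w, size v = n.+1 -> size w = n.+1 -> v != w -> forall x y,
    ball (s'.1 v) s'.2 x -> ball (s'.1 w) s'.2 y -> G n (x - y)].

Let exists_next n s : 0 < s.2 -> exists2 s', 0 < s'.2 & next n s s'.
Proof.
move=> r0; have [Go Gd] := G_open_dense n.
pose W w := if w == false :: nseq n true then O n
            else ball (s.1 (behead w)) (s.2 / 4).
have [|x [r [r_gt0 xW xG]]] :=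
    generic_balls (strings n.+1) Go Gd (@G_opp n) (W := W).
  move=> w; rewrite /W; case: ifP => _; first exact: O_open.
  split; first exact: open_fnorm_ball.
  by exists (s.1 (behead w)); apply: fnorm_ball_center; rewrite ?divr_gt0.
exists (x, Num.min r (s.2 / 2)); first by rewrite lt_min r_gt0 divr_gt0.
split=> [|c w wn u|v w vn wn vw u u'] /=.
- by rewrite ge_min lexx orbT.
- rewrite lt_min => /andP[+ _]; apply: (xW (c :: w)).
  by rewrite -wn; exact: (mem_strings (c :: w)).
- rewrite !lt_min => /andP[uv _] /andP[uw _].
  by apply: (xG v w) => //; [rewrite -vn|rewrite -wn].
Qed.

(** Mycielski's theorem for the relation [x - y \in G n] for all large [n]. At
level [n] of the tree finitely many balls have to be chosen, hence all their
differences can be put in [G n]; the points at distinct branches lie in distinct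
balls from some level on. Since the balls of a level shrink and, as [0] is not in
[G n], are disjoint, each branch depends continuously on the point and
conversely. *)
Theorem Mycielski : exists K : nat -> set X,
  (forall j, cantor_set R (K j) /\ K j `<=` O j) /\
  forall x y, (\bigcup_j K j) x -> (\bigcup_j K j) y -> x <> y ->
    exists m, forall n, (m <= n)%N -> G n (x - y).
Proof.
have [||s [s0 r0 sS]] := @dependent_sequence _ ((fun=> 0) : seq bool -> X, 1 : R)
  (fun s => 0 < s.2) next; [exact: ltr01|exact: exists_next|].
pose c n b := (s n).1 (prefix_rev b n); pose r n := (s n).2.
have rS n : r n.+1 <= r n / 2 by case: (sS n).
have cS j b n : (j < n)%N ->
    ball (c n (branch j b)) (r n / 4) (c n.+1 (branch j b)).
  move=> jn; have [_ /(_ (branch j b n) (prefix_rev (branch j b) n))] := sS n.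
  rewrite size_prefix_rev => /(_ erefl)/(_ (c n.+1 (branch j b))) + _.
  rewrite -prefix_revS; case: ifP => [/eqP e _|_]; last first.
    by apply; rewrite /c; apply: fnorm_ball_center.
  (* the branch has a zero at the position [j], and [j < n]: it cannot meet the
     node that starts the Cantor set of index [n] *)
  have := congr1 (fun t => nth true t (n - j)) e.
  rewrite /prefix_rev nth_rev size_mkseq ?ltnS ?leq_subr//.
  rewrite subSS subKn ?(ltnW jn)// nth_mkseq ?leqW//.
  rewrite {1}/branch ltnn eqxx.
  by case: (n - j)%N (subn_gt0 j n) => [|d _ /=]; rewrite ?jn// nth_nseq; case: ifP.
have /choice[phi phiP] : forall jb : nat * (nat -> bool), exists l : X,
    forall n, (jb.1 < n)%N -> ball (c n (branch jb.1 jb.2)) (r n) l.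
  move=> [j b] /=.
  have [|||l lP] := shrinking_balls_limit p_seminorm p_increasing p_topology
    X_complete (x := fun i => c (i + j.+1)%N (branch j b))
    (r := fun i => r (i + j.+1)%N).
  - by move=> i; exact: r0.
  - by move=> i; rewrite addSn; exact: rS.
  - by move=> i; rewrite addSn; apply: cS; rewrite leq_addl.
  by exists l => n jn; have := lP (n - j.+1)%N; rewrite subnK.
have prefix_sep n b b' : ~ agree n.+1 b b' -> forall u v,
    ball (c n.+1 b) (r n.+1) u -> ball (c n.+1 b') (r n.+1) v -> G n (u - v).
  move=> bb'; have [_ _ h] := sS n; apply: h; rewrite ?size_prefix_rev//.
  by apply/eqP => /prefix_revP.
have r_small e : 0 < e -> exists n, forall m, (n <= m)%N -> r m < e.
  move=> e0; have r_le n : r n <= 2^-1 ^+ n.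
    elim: n => [|n IH]; first by rewrite expr0 /r s0.
    by rewrite exprS; have := rS n; lra.
  have [n hn] := exists_half_pow_lt e0; exists n.+1 => m nm.
  apply: le_lt_trans (r_le m) (le_lt_trans _ hn).
  by rewrite ler_wiXn2l ?invr_ge0 ?invf_le1 ?ler1n.
exists (fun j => range (fun b => phi (j, b))); split=> [j|].
  split; last first.
    move=> _ [b _ <-]; have [_ /(_ false (nseq j true)) h _] := sS j.
    have := phiP (j, b) j.+1 (leqnn _); rewrite /c /= prefix_revS.
    have -> : prefix_rev (branch j b) j = nseq j true.
      apply: (@eq_from_nth _ true); rewrite ?size_prefix_rev ?size_nseq// => i ij.
      rewrite nth_nseq ij nth_rev ?size_mkseq// nth_mkseq ?ltn_subrL//; last first.
        by case: (j) ij.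
      rewrite /branch ifT//; case: (j) ij => // j' _; rewrite subSS ltnS.
      exact: leq_subr.
    rewrite {1}/branch ltnn eqxx => h'; move: h; rewrite size_nseq eqxx; exact.
  apply: cantor_set_range => [b U|b n].
    move=> /nbhsP[e e0 eU]; have [n rn] := r_small _ (divr_gt0 e0 (ltr0Sn R 1)).
    exists (maxn n j.+1) => b' bb'; apply: eU.
    have jm : (j < maxn n j.+1)%N by rewrite leq_max leqnn orbT.
    have := phiP (j, b) _ jm; have := phiP (j, b') _ jm => /=.
    have -> : c (maxn n j.+1) (branch j b') = c (maxn n j.+1) (branch j b).
      rewrite /c; congr ((s _).1 _); apply/esym/prefix_revP => i im; rewrite /branch.
      case: ifP => // ij; case: ifP => // _; apply: bb'.
      exact: leq_ltn_trans (leq_subr _ _) im.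
    rewrite (fnormBC p_seminorm (phi (j, b))) => h1 h2.
    have := fnormD p_seminorm (phi (j, b') - c (maxn n j.+1) (branch j b))
      (c (maxn n j.+1) (branch j b) - phi (j, b)).
    rewrite addrA subrK; have := rn _ (leq_maxl n j.+1); lra.
  have jn : (j < (n + j).+1)%N by rewrite ltnS leq_addl.
  exists (ball (c (n + j).+1 (branch j b)) (r (n + j).+1)).
    apply: open_nbhs_nbhs; split; first exact: open_fnorm_ball.
    exact: (phiP (j, b)).
  move=> b' hb'; have : agree (n + j).+1 (branch j b) (branch j b').
    apply: contrapT => /prefix_sep/(_ _ _ hb' (phiP (j, b') _ jn)).
    by rewrite subrr; exact: G_not0.
  move=> bb' i ni; have := bb' (i + j.+1)%N.
  rewrite /branch addnS ltnS ltn_add2r ni ltnNge leqW ?leq_addl//=.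
  rewrite gtn_eqF ?ltnS ?leq_addl// subSS addnK; exact.
move=> _ _ [j _ [b _ <-]] [j' _ [b' _ <-]] neq.
have [i ii] : exists i, branch j b i <> branch j' b' i.
  apply: contrapT => /forallNP h; apply: neq; congr phi.
  have hh i : branch j b i = branch j' b' i by apply: contrapT.
  have jj' : j = j'.
    have := hh j; have := hh j'; rewrite /branch !ltnn !eqxx.
    by case: ltngtP => // _; case: ltngtP.
  congr pair => //; apply/funext => i; have := hh (i + j.+1)%N.
  rewrite /branch -jj' addnS ltnNge leqW ?leq_addl//=.
  by rewrite gtn_eqF ?ltnS ?leq_addl// subSS addnK.
exists (maxn i (maxn j j')) => n; rewrite !geq_max => /and3P[ni nj nj'].
apply: (prefix_sep _ (branch j b) (branch j' b')).
- by move=> /(_ i ni).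
- exact: (phiP (j, b)).
- exact: (phiP (j', b')).
Qed.

End Mycielski.

(** * Orbits of a continuous linear operator *)

Section LinearDynamics.
Context {R : realType} {k : scalar_field} {X : tvsType (scalars R k)}.
Context {p : nat -> X -> R} {T : {linear X -> X}}.
Context (p_seminorm : forall j, seminorm (p j)).
Context (p_increasing : increasing_seminorms p) (p_topology : induces_topology p).
Context (T_continuous : continuous T).
Implicit Types (x y u : X) (c e : R) (q : nat).

Local Notation N := (fnorm (p := p)).

Let nbhsP := nbhs_fnorm p_seminorm p_increasing p_topology.
Let openP := open_fnormP p_seminorm p_increasing p_topology.

Lemma iter_add n x y : iter n T (x + y) = iter n T x + iter n T y.
Proof. by elim: n => //= n ->; rewrite raddfD. Qed.

Lemma iter_muln n x i : iter n T (x *+ i) = iter n T x *+ i.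
Proof. by elim: n => //= n ->; rewrite raddfMn. Qed.

Lemma iter_zero n : iter n T 0 = 0.
Proof. by elim: n => //= n ->; rewrite raddf0. Qed.

Lemma iter_opp n x : iter n T (- x) = - iter n T x.
Proof. by elim: n => //= n ->; rewrite raddfN. Qed.

Lemma iter_sub n x y : iter n T (x - y) = iter n T x - iter n T y.
Proof. by rewrite iter_add iter_opp. Qed.

Lemma iter_continuous n : continuous (iter n T).
Proof.
elim: n => [|n IH] x; first exact: cvg_id.
exact: (continuous_comp (IH x) (@T_continuous _)).
Qed.

Lemma dist_iter n x y : dist p (iter n T x) (iter n T y) = N (iter n T (x - y)).
Proof. by rewrite distE iter_sub. Qed.

Lemma dist_iter0 n x : dist p (iter n T 0) (iter n T x) = N (iter n T x).
Proof. by rewrite dist_iter sub0r iter_opp (fnormN p_seminorm). Qed.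

Lemma dist_proximal_sub x y : dist_proximal p T x y -> proximal_cell0 p T (y - x).
Proof.
move=> h e /h <-; congr (upper_density _); apply/funext => n /=.
by rewrite dist_iter0 dist_iter -(fnormN p_seminorm) -iter_opp opprB.
Qed.

Lemma dist_proximal_refl x : dist_proximal p T x x.
Proof.
move=> e e0; rewrite -[RHS](@density_setT R); congr (upper_density _).
by apply/funext => n; apply/propext; rewrite /= distE subrr (fnorm0 p_seminorm).
Qed.

Lemma proximal_cellP x : proximal_cell0 p T x <->
  forall e, 0 < e -> upper_density [set n | N (iter n T x) < e] = 1 :> R.
Proof.
have E e : [set n | N (iter n T x) < e] =
    [set n | dist p (iter n T 0) (iter n T x) < e].
  by apply/funext => n /=; rewrite dist_iter0.
by split=> h e /h; rewrite E.
Qed.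

Definition frequent_visits c n (O : set X) : set X :=
  [set x | exists2 m, (n <= m)%N &
     c * m%:R < (hits [set i | O (iter i T x)] m)%:R].

Lemma open_frequent_visits c n (O : set X) : open O -> open (frequent_visits c n O).
Proof.
move=> Oo; rewrite openE => x [m nm cm].
have : \forall y \near x, forall i, (i < m.+1)%N -> O (iter i T x) -> O (iter i T y).
  elim: m.+1 => [|l IH]; first exact: nearW.
  have : \forall y \near x, O (iter l T x) -> O (iter l T y).
    have [Ox|nOx] := pselect (O (iter l T x)); last by apply: nearW.
    have : nbhs x (iter l T @^-1` O).
      by apply: (@iter_continuous l x); exact: open_nbhs_nbhs.
    by apply: filterS => y.
  move: IH; apply: filterS2 => y IH yl i.
  by rewrite ltnS leq_eqVlt => /predU1P[->|/IH].
apply: filterS => y h; exists m => //; apply: lt_le_trans cm _.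
rewrite ler_nat -[leqRHS]addn0; apply: hits_sub => i /andP[_ im].
exact: h.
Qed.

Definition near0 n : set X := [set u | N u < 2^-1 ^+ n].

Definition beyond q (M : R) : set X := [set u | M < p q u].

(** The [n]-th approximation to a vector whose orbit is distributionally
proximal to [0] and has [p q] unbounded along times of upper density at least
[c]. Membership is witnessed by finitely many iterates, which makes the set open. *)
Definition irregular_approx q c n : set X :=
  frequent_visits (1 - 2^-1 ^+ n) n (near0 n) `&`
  frequent_visits c n (beyond q n%:R).

Lemma open_near0 n : open (near0 n).
Proof.
have := open_fnorm_ball p_seminorm p_increasing p_topology 0 (2^-1 ^+ n).
by congr open; apply/funext => u /=; rewrite subr0.
Qed.

Lemma open_beyond q M : open (beyond q M).
Proof.
rewrite openE => u /= Mu; rewrite /interior p_topology.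
exists q, (p q u - M); split=> [|v /= /(_ q (leqnn _)) h]; first by rewrite subr_gt0.
have := seminormD p_seminorm q (u - v) v; rewrite subrK.
by rewrite -(seminormN p_seminorm q (u - v)) opprB /beyond /=; lra.
Qed.

Lemma open_irregular_approx q c n : open (irregular_approx q c n).
Proof.
apply: openI; apply: open_frequent_visits; last exact: open_beyond.
exact: open_near0.
Qed.

Lemma irregular_approx_opp q c n x :
  irregular_approx q c n x -> irregular_approx q c n (- x).
Proof.
have opp_visits a (O : set X) : (forall u, O u -> O (- u)) ->
    frequent_visits a n O x -> frequent_visits a n O (- x).
  move=> Oopp [m nm am]; exists m => //; apply: lt_le_trans am _.
  rewrite ler_nat -[leqRHS]addn0; apply: hits_sub => i _ /= /Oopp.
  by rewrite iter_opp.
move=> [h1 h2]; split; apply: opp_visits => // u.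
  by rewrite /near0 /= (fnormN p_seminorm).
by rewrite /beyond /= (seminormN p_seminorm).
Qed.

Lemma irregular_approx_not0 q c n : 0 <= c -> ~ irregular_approx q c n 0.
Proof.
move=> c0 [_ [m _ cm]].
have [|i] := @hits_gt0 [set i | beyond q n%:R (iter i T 0)] m.
  by rewrite -(ltr_nat R); apply: le_lt_trans cm; rewrite mulr_ge0.
by rewrite /beyond /= iter_zero (seminorm0 p_seminorm) ltNge ler0n.
Qed.

Definition proximal_unbounded q c x := proximal_cell0 p T x /\
  forall M, c <= upper_density [set n | M < p q (iter n T x)] :> R.

Lemma proximal_unboundedP q c x m :
  (forall n, (m <= n)%N -> irregular_approx q c n x) -> proximal_unbounded q c x.
Proof.
move=> h; split; last first.
  move=> M; apply: density_of_often => l.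
  have [K MK] : exists K : nat, M < K%:R.
    by exists (Num.truncn M).+1; exact: truncnS_gt.
  have [_ [n]] := h (maxn m (maxn l K)) (leq_maxl _ _).
  rewrite !geq_max => /and3P[_ ln Kn] cn; exists n => //.
  apply: lt_le_trans cn _; rewrite ler_nat -[leqRHS]addn0; apply: hits_sub.
  move=> i _; rewrite /beyond /=; apply: lt_trans.
  by apply: lt_le_trans MK _; rewrite ler_nat !leq_max leqnn !orbT.
apply/proximal_cellP => e e0; apply/density_eq1/density_ge => c' c1 l.
have [K hK] := exists_half_pow_lt e0.
have [K' hK'] := @exists_half_pow_lt _ (1 - c') ltac:(by rewrite subr_gt0).
pose j := maxn m (maxn l (maxn K.+1 K'.+1)).
have half_le a : (a <= j)%N -> 2^-1 ^+ j <= 2^-1 ^+ a :> R.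
  by move=> aj; rewrite ler_wiXn2l ?invr_ge0 ?invf_le1 ?ler1n.
have [[n jn cn] _] := h j (leq_maxl _ _).
have ln : (l <= n)%N by apply: leq_trans jn; rewrite !leq_max leqnn !orbT.
exists n => //; apply: le_lt_trans (lt_le_trans cn _).
  rewrite ler_wpM2r//; have := half_le K'.+1; rewrite !leq_max leqnn !orbT.
  by move=> /(_ isT); lra.
rewrite ler_nat -[leqRHS]addn0; apply: hits_sub => i _.
rewrite /near0 /= => /lt_le_trans; apply; apply: le_trans (ltW hK).
by apply: half_le; rewrite !leq_max leqnn !orbT.
Qed.

Lemma cvg_within_infty (A : set nat) (f : nat -> X) :
  (forall e, 0 < e -> exists M, forall n, (M < n)%N -> A n -> N (f n) < e) ->
  f n @[n --> within A \oo] --> (0 : X).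
Proof.
move=> h U /nbhsP[e /h[M hM] eU]; exists M.+1 => // n /= Mn An; apply: eU.
by rewrite subr0; exact: hM.
Qed.

Lemma irregular2_of_proximal_unbounded q c x : 0 < c ->
  proximal_unbounded q c x -> irregular2 p T q x.
Proof.
move=> c0 [/proximal_cellP xprox xunb]; split.
  have [||A [A1 Ah]] := @density_pick R 1 (fun n => [set i | near0 n (iter i T x)]).
  - move=> n i; rewrite /near0 /= => /lt_le_trans; apply.
    by rewrite exprS; have := exprn_ge0 n (_ : 0 <= 2^-1 :> R); lra.
  - by move=> n; rewrite xprox// exprn_gt0// invr_gt0.
  exists A; split; first exact: density_eq1.
  apply: cvg_within_infty => e /exists_half_pow_lt[n hn].
  have [M hM] := Ah n.+1; exists M => i Mi /(hM i Mi); rewrite /near0 /= => h.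
  exact: lt_trans hn.
have [||B [B1 Bh]] := @density_pick R c (fun n => [set i | beyond q n%:R (iter i T x)]).
- move=> n i; rewrite /beyond /=; apply: le_lt_trans.
  by rewrite ler_nat.
- by move=> n; exact: xunb.
exists B; split; first exact: lt_le_trans c0 B1.
apply/cvgryPgt => M.
have [K MK] : exists K : nat, M < K%:R.
  by exists (Num.truncn M).+1; exact: truncnS_gt.
have [L hL] := Bh K; exists L.+1 => // n /= Ln /(hL n Ln).
exact: lt_trans.
Qed.

Lemma fnorm_ge_of_seminorm q u : 1 < p q u -> 2^-1 ^+ q.+1 <= N u.
Proof.
move=> h; rewrite leNgt; apply/negP => Nu.
have := @seminorm_lt_of_fnorm _ _ _ _ p_seminorm q u 1 (lexx _).
by rewrite mulr1 => /(_ Nu); lra.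
Qed.

Lemma irregular2_semi q x : irregular2 p T q x -> semi_irregular2 p T x.
Proof.
move=> [xA [B [B0 /cvgryPgt /(_ 1) Binf]]]; split=> //; exists B; split=> //.
rewrite limf_einfE.
apply: (@lt_le_trans _ _ (2^-1 ^+ q.+1)%:E).
  by rewrite lte_fin exprn_gt0// invr_gt0.
apply: le_trans (ereal_sup_ubound _); last first.
  by exists [set n | 1 < p q (iter n T x)]; first exact: Binf.
by apply/ereal_infP => _ [n /= h <-]; rewrite lee_fin; exact: fnorm_ge_of_seminorm.
Qed.

Lemma semi_irregular2_proximal x : semi_irregular2 p T x -> proximal_cell0 p T x.
Proof.
move=> [[A [A1 xA]] _]; apply/proximal_cellP => e e0; apply: density_eq1.
rewrite -A1; have /xA[M _ hM] : nbhs (0 : X) [set u | N u < e].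
  by apply/nbhsP; exists e => // u; rewrite subr0.
by apply: (@density_eventually _ M) => n Mn An; exact: hM.
Qed.

Lemma semi_irregular2_far x : semi_irregular2 p T x ->
  exists2 e, 0 < e & 0 < upper_density [set n | e < dist p (iter n T x) 0] :> R.
Proof.
move=> [_ [B [B0]]]; rewrite limf_einfE => /ereal_sup_gt[_ [V BV <-] V0].
have [e e0 eV] : exists2 e : R, 0 < e &
    (e%:E < ereal_inf [set (dist p (iter n T x) 0)%:E | n in V])%E.
  case: (ereal_inf _) V0 => [r||] //; last by move=> _; exists 1; rewrite ?ltry.
  rewrite lte_fin => r0; exists (r / 2); first by rewrite divr_gt0.
  by rewrite lte_fin; lra.
exists e => //; apply: lt_le_trans B0 _; case: BV => M _ hM.
apply: (@density_eventually _ M) => n Mn Bn /=; rewrite -lte_fin.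
by apply: lt_le_trans eV (ereal_inf_lbound _); exists n => //; exact: hM.
Qed.

(** One orbit that is often far from [0] yields arbitrarily small vectors with
such orbits. Let [y] be close to [x] and proximal to [0]. Either the small vector
[x - y] inherits half of the instability of [x], or [y] does. In the second case
the orbit of [y] visits the ball of radius [e] at some time [i], and the small
vector [iter i T y] has the same orbit up to a shift, which preserves upper
density. *)
Lemma unstable_at0 :
  dense (proximal_cell0 p T) ->
  (exists x e, 0 < e /\
     0 < upper_density [set n | e < dist p (iter n T x) 0] :> R) ->
  exists2 d, 0 < d & forall e, 0 < e -> exists2 y, N y < e &
    d <= upper_density [set n | d < N (iter n T y)].
Proof.
move=> cell_dense [x [a [a0]]]; set b := upper_density _ => b0.
pose d := Num.min a b / 2; exists d; first by rewrite divr_gt0// lt_min a0.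
have [da db] : d + d <= a /\ d + d <= b.
  by rewrite /d -splitr !ge_min !lexx orbT.
move=> e e0.
have [|y [/= xy /proximal_cellP yprox]] := cell_dense [set y | N (y - x) < e] _
    (open_fnorm_ball p_seminorm p_increasing p_topology _ _).
  by exists x; exact: fnorm_ball_center.
pose far z : R := upper_density [set n | d < N (iter n T z)].
have split_x : b <= far (x - y) + far y.
  apply: le_trans (densityU _ _); apply: density_sub => n /=; rewrite distE subr0 => h.
  have := fnormD p_seminorm (iter n T (x - y)) (iter n T y).
  rewrite -iter_add subrK; case: (ltP d (N (iter n T (x - y)))); first by left.
  by move=> h1 h2; right; lra.
have [h|h] : d <= far (x - y) \/ far (x - y) < d by apply/orP; case: leP.
  by exists (x - y); first by rewrite (fnormBC p_seminorm).
have [i yi] : exists i, N (iter i T y) < e.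
  have [|i _ hi] := @often_of_density R (1 / 2) [set n | N (iter n T y) < e] _ 0%N.
    by rewrite yprox// ltr_pdivrMr// mul1r ltr1n.
  have [|j yj] := @hits_gt0 [set n | N (iter n T y) < e] i.
    by rewrite -(ltr_nat R); apply: le_lt_trans hi; rewrite mulr_ge0// divr_ge0.
  by exists j.
have dy : d <= far y.
  by move: split_x h db; move: (far (x - y)) (far y) => f1 f2; lra.
exists (iter i T y); first exact: yi.
apply: le_trans dy (le_trans (density_shift _ i) (density_sub _)) => n /=.
by rewrite iterD.
Qed.

Lemma unstable_seminorm :
  (exists2 d, 0 < d & forall e, 0 < e -> exists2 y, N y < e &
    d <= upper_density [set n | d < N (iter n T y)]) ->
  exists q c a, [/\ 0 < c, 0 < a & forall e, 0 < e -> exists2 y, N y < e &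
    c < upper_density [set n | a < p q (iter n T y)]].
Proof.
move=> [d d0 dT]; have [q hq] := exists_half_pow_lt (divr_gt0 d0 (ltr0Sn R 1)).
exists q, (d / 2), (d / 2); split; rewrite ?divr_gt0// => e /dT[y ye yd].
exists y => //; apply: lt_le_trans (le_trans yd (density_sub _)); first by lra.
move=> n; rewrite /= !ltNge; apply: contra => h.
have := fnorm_le_of_seminorm p_seminorm p_increasing h; lra.
Qed.

(** A multiple [y *+ l] of a small unstable vector is still small while its
orbit is often beyond [2 * n]; then [z] or [z + y *+ l] is often beyond [n]. The
density is halved once, independently of [n]. *)
Lemma dense_frequently_beyond q c a n : 0 < a ->
  (forall e, 0 < e -> exists2 y, N y < e &
    c < upper_density [set i | a < p q (iter i T y)]) ->
  dense (frequent_visits (c / 2) n (beyond q n%:R)).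
Proof.
move=> a0 aT O [z Oz] Oo; have [r r0 rO] := (openP _).1 Oo z Oz.
have [l hl] : exists l : nat, 2 * n%:R / a < l%:R.
  by exists (Num.truncn (2 * n%:R / a)).+1; exact: truncnS_gt.
have [|y yr yc] := aT (r / l.+1%:R); first by rewrite divr_gt0.
pose S x := [set i | beyond q n%:R (iter i T x)].
have : often (c / 2 + c / 2) (S z `|` S (z + y *+ l)).
  rewrite -splitr; apply: often_of_density; apply: lt_le_trans yc (density_sub _).
  move=> i /= ai; case: (ltP n%:R (p q (iter i T z))) => nz; first by left.
  right; rewrite /S /beyond /= iter_add iter_muln.
  have := seminormD p_seminorm q (iter i T z + iter i T y *+ l) (- iter i T z).
  rewrite addrAC subrr add0r (seminormN p_seminorm) (seminormMn p_seminorm).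
  have : l%:R * a <= l%:R * p q (iter i T y) by rewrite ler_wpM2l// ltW.
  by move: hl; rewrite ltr_pdivrMr//; lra.
case/often_setU => [/(_ n) Sz|/(_ n) Szy]; [exists z|exists (z + y *+ l)] => //.
split=> //; apply: rO => /=; rewrite addrAC subrr add0r.
apply: le_lt_trans (fnormMn p_seminorm y l) _.
move: yr; rewrite ltr_pdivlMr//; apply: le_lt_trans.
by rewrite mulrC ler_wpM2l ?fnorm_ge0// ler_nat.
Qed.

Lemma dense_frequently_near0 n : dense (proximal_cell0 p T) ->
  dense (frequent_visits (1 - 2^-1 ^+ n) n (near0 n)).
Proof.
move=> cell_dense O O0 /(cell_dense _ O0)[x [Ox /proximal_cellP xprox]].
exists x; split=> //; apply: often_of_density; rewrite xprox ?exprn_gt0 ?invr_gt0//.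
Qed.

Lemma dense_irregular_approx :
  dense (proximal_cell0 p T) ->
  (exists x e, 0 < e /\
     0 < upper_density [set n | e < dist p (iter n T x) 0] :> R) ->
  exists q c, 0 < c /\
    forall n, open (irregular_approx q c n) /\ dense (irregular_approx q c n).
Proof.
move=> cell_dense xP.
have [q [c [a [c0 a0 aT]]]] := unstable_seminorm (unstable_at0 cell_dense xP).
exists q, (c / 2); split=> [|n]; first by rewrite divr_gt0.
split; first exact: open_irregular_approx.
apply: denseI; [|exact: dense_frequently_near0|exact: dense_frequently_beyond aT].
exact/open_frequent_visits/open_near0.
Qed.

Lemma extremely_chaotic2_beyond q c x y : extremely_chaotic2 p T q c x y ->
  forall M, c <= upper_density [set n | M < p q (iter n T (x - y))] :> R.
Proof.
move=> [_ h] M; have M1 : 0 < Num.max M 1 by rewrite lt_max ltr01 orbT.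
apply: le_trans (h _ M1) (density_sub _) => n /=.
by rewrite iter_sub; apply: le_lt_trans; rewrite le_max lexx.
Qed.

End LinearDynamics.

(** * Equivalence of the conditions *)

Section Equivalences.
Context {R : realType} {k : scalar_field} {X : tvsType (scalars R k)}.
Context {p : nat -> X -> R} {T : {linear X -> X}}.
Context (p_seminorm : forall j, seminorm (p j)).
Context (p_increasing : increasing_seminorms p) (p_topology : induces_topology p).
Context (X_complete : complete_dist p) (T_continuous : continuous T).

Let openP := open_fnormP p_seminorm p_increasing p_topology.
Let open_ball := open_fnorm_ball p_seminorm p_increasing p_topology.
Let Baire := frechet_Baire p_seminorm p_increasing p_topology X_complete.

Definition dense_cell_far_orbit := dense (proximal_cell0 p T) /\
  exists (x : X) (delta : R), 0 < delta /\
    0 < upper_density [set n | delta < dist p (iter n T x) 0] :> R.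

Definition scrambled_cantor_families := exists (m : nat) (delta : R), 0 < delta /\
  forall O : nat -> set X, (forall j, open (O j) /\ O j !=set0) ->
  exists K : nat -> set X,
    (forall j, cantor_set R (K j) /\ K j `<=` O j) /\
    extremely_scrambled2 p T m delta (\bigcup_j K j).

Lemma dense_cell_far_orbit_of_semi_irregular2 :
  dense [set x | semi_irregular2 p T x] -> dense_cell_far_orbit.
Proof.
move=> Td; split.
  move=> O O0 /(Td _ O0)[x [Ox xT]]; exists x; split=> //.
  exact: (semi_irregular2_proximal p_seminorm p_increasing p_topology).
have [x [_ /semi_irregular2_far[e e0 xe]]] := Td setT (ex_intro _ 0 I) openT.
by exists x, e.
Qed.

Lemma residual_irregular2 :
  dense_cell_far_orbit -> exists q, residual [set x | irregular2 p T q x].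
Proof.
move=> [cell_dense /(dense_irregular_approx p_seminorm p_increasing p_topology
  T_continuous cell_dense)[q [c [c0 God]]]]; exists q.
exists (\bigcap_n irregular_approx (p := p) (T := T) q c n).
  split; last exact: Baire.
  by exists (irregular_approx (p := p) (T := T) q c) => // n; case: (God n).
move=> x Gx.
apply: (irregular2_of_proximal_unbounded p_seminorm p_increasing p_topology c0).
by apply: (proximal_unboundedP p_seminorm (m := 0)) => n _; exact: Gx.
Qed.

Lemma dense_semi_irregular2_of_residual q :
  residual [set x | irregular2 p T q x] -> dense [set x | semi_irregular2 p T x].
Proof.
move=> [G [[F Fo ->] Gd] Girr] O O0 /(Gd _ O0)[x [Ox Gx]]; exists x; split=> //.
exact: (irregular2_semi p_seminorm (Girr _ Gx)).
Qed.

(** The density [c] of [dense_irregular_approx] does not depend on the vector,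
and becomes the uniform [delta]: a residual set of irregular vectors alone would
allow it to vary with the vector. *)
Lemma scrambled_cantor_families_of_far_orbit :
  dense_cell_far_orbit -> scrambled_cantor_families.
Proof.
move=> [cell_dense /(dense_irregular_approx p_seminorm p_increasing p_topology
  T_continuous cell_dense)[m [c [c0 God]]]].
exists m, c; split=> // O O_open.
have [||K [KO KG]] := Mycielski p_seminorm p_increasing p_topology X_complete
  God _ _ O_open.
- by move=> n u; exact: irregular_approx_opp.
- by move=> n; apply: irregular_approx_not0 => //; exact: ltW.
exists K; split=> // x y Kx Ky xy.
have [n nG] := KG x y Kx Ky xy.
have [/(proximal_cellP p_seminorm) xyprox xyunb] := proximal_unboundedP p_seminorm nG.
split=> [e e0|M _].
  rewrite -[RHS](xyprox e e0); congr (upper_density _).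
  by apply/funext => i; rewrite /= dist_iter.
rewrite (le_trans (xyunb M))//; apply: density_sub => i /=.
by rewrite iter_sub.
Qed.

(** Two distinct points [u], [v] of one Cantor set close to [x] drift apart
with density [delta]; hence one of them drifts apart from [x] with density at
least [delta / 2]. *)
Lemma proximal_unstable_of_scrambled_cantor_families :
  scrambled_cantor_families ->
  dense (proximal_relation p T) /\ mean_L_unstable p T.
Proof.
move=> [m [d [d0 scr]]]; split.
  move=> O [[x y] Oxy] Oo.
  have [[U V] /= [Ux Vy] UVO] : nbhs (x, y) O by apply: open_nbhs_nbhs.
  have [|K [KO Kscr]] := scr (fun j => if j is 0%N then interior U else interior V).
    by case=> [|j]; split; [exact: open_interior|exists x|exact: open_interior|exists y].
  have [[K0 K0U] [K1 K1V]] := (KO 0%N, KO 1%N).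
  have [[u [_ [Ku _ _]]] [v [_ [Kv _ _]]]] :=
    (cantor_set_two_points K0, cantor_set_two_points K1).
  exists (u, v); split.
    by apply: UVO; split; apply: interior_subset; [exact: K0U|exact: K1V].
  rewrite /proximal_relation /=; have [->|uv] := pselect (u = v).
    exact: dist_proximal_refl.
  by have [] := Kscr u v (ex_intro2 _ _ 0%N I Ku) (ex_intro2 _ _ 1%N I Kv) uv.
exists (Num.min (d / 2) (2^-1 ^+ m.+2)).
  by rewrite lt_min divr_gt0// exprn_gt0// invr_gt0.
move=> x e e0.
have [|K [KO Kscr]] := scr (fun=> [set u | fnorm (p := p) (u - x) < e]).
  by move=> _; split; [exact: open_ball|exists x; exact: fnorm_ball_center].
have [K0 K0x] := KO 0%N; have [u [v [Ku Kv uv]]] := cantor_set_two_points K0.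
have uv_chaotic := Kscr u v (ex_intro2 _ _ 0%N I Ku) (ex_intro2 _ _ 0%N I Kv) uv.
have := extremely_chaotic2_beyond uv_chaotic 2 => duv.
pose S w := [set n | 2^-1 ^+ m.+2 < dist p (iter n T x) (iter n T w)].
have : d <= upper_density (S u) + upper_density (S v).
  apply: le_trans duv (le_trans (density_sub _) (densityU _ _)) => n /= n2.
  have big w : 1 < p m (iter n T (x - w)) -> S w n.
    move=> /(fnorm_ge_of_seminorm p_seminorm); rewrite /S /= dist_iter.
    apply: lt_le_trans; rewrite exprS.
    by have : 0 < 2^-1 ^+ m.+1 :> R; [rewrite exprn_gt0// invr_gt0|lra].
  case: (ltP 1 (p m (iter n T (x - u)))) => [/big|xu]; first by left.
  right; apply: big.
  have := seminormD p_seminorm m (iter n T (x - v)) (- iter n T (x - u)).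
  rewrite (seminormN p_seminorm) -iter_opp -iter_add opprB addrC addrA subrK.
  lra.
have near w : K 0%N w -> dist p x w < e.
  by move=> /K0x; rewrite distE (fnormBC p_seminorm).
have far w : d / 2 <= upper_density (S w) ->
    Num.min (d / 2) (2^-1 ^+ m.+2) <= upper_density [set n |
      Num.min (d / 2) (2^-1 ^+ m.+2) < dist p (iter n T x) (iter n T w)].
  move=> dw; apply: le_trans (le_trans dw (density_sub _)).
    by rewrite ge_min lexx.
  by move=> n; apply: le_lt_trans; rewrite ge_min lexx orbT.
move/half_le_of_le_sum => [Su|Sv].
- by exists u; [exact: near|exact: far].
- by exists v; [exact: near|exact: far].
Qed.

Lemma dense_cell_far_orbit_of_unstable :
  dense (proximal_relation p T) /\ mean_L_unstable p T -> dense_cell_far_orbit.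
Proof.
move=> [rel_dense [d d0 unst]]; split.
  move=> O [x Ox] Oo.
  have [||[u v] [/= Ouv /(dist_proximal_sub p_seminorm) uv]] :=
      rel_dense [set uv : X * X | O (uv.2 - uv.1)].
  - by exists (0, x); rewrite /= subr0.
  - rewrite openE => -[u v] /= /((openP _).1 Oo)[e e0 eO].
    exists ([set u' | fnorm (p := p) (u' - u) < e / 2],
            [set v' | fnorm (p := p) (v' - v) < e / 2]).
      by split; apply: open_nbhs_nbhs; split; [exact: open_ball| |exact: open_ball|];
        apply: fnorm_ball_center; rewrite ?divr_gt0.
    move=> [u' v'] /= [u'u v'v]; apply: eO => /=.
    have := fnormD p_seminorm (v' - v) (- (u' - u)).
    have -> : v' - v - (u' - u) = v' - u' - (v - u).
      by rewrite !opprB addrACA [RHS]addrACA [- v + _]addrC.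
    by rewrite (fnormN p_seminorm); lra.
  - by exists (v - u).
have [y _ yd] := unst 0 1 ltr01; exists y, d; split; first exact: d0.
apply: lt_le_trans d0 (le_trans yd (density_sub _)) => n /=.
by rewrite (dist_iter0 p_seminorm) distE subr0.
Qed.

End Equivalences.

Theorem theorem5p30 (R : realType) (k : scalar_field)
  (X : tvsType (scalars R k)) (p : nat -> X -> R) (T : {linear X -> X})
  (X_infdim : infinite_dimensional X)
  (p_seminorm : forall j, seminorm (p j))
  (p_separating : separating p)
  (p_increasing : increasing_seminorms p)
  (p_topology : induces_topology p)
  (X_complete : complete_dist p)
  (T_continuous : continuous T) :
  [<->
    dense [set x | semi_irregular2 p T x];
    exists m : nat, residual [set x | irregular2 p T m x];
    exists (m : nat) (delta : R), 0 < delta /\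
      forall O : nat -> set X, (forall j, open (O j) /\ O j !=set0) ->
      exists K : nat -> set X,
        (forall j, cantor_set R (K j) /\ K j `<=` O j) /\
        extremely_scrambled2 p T m delta (\bigcup_j K j);
    dense (proximal_relation p T) /\ mean_L_unstable p T;
    dense (proximal_cell0 p T) /\
      exists (x : X) (delta : R), 0 < delta /\
        0 < upper_density [set n | delta < dist p (iter n T x) 0] :> R].
Proof.
have of_semi := dense_cell_far_orbit_of_semi_irregular2 p_seminorm p_increasing
  p_topology (T := T).
have to_residual := residual_irregular2 p_seminorm p_increasing p_topology
  X_complete T_continuous.
have of_residual := dense_semi_irregular2_of_residual p_seminorm (T := T).
tfae.
- by move=> /of_semi/to_residual.
- by move=> [q /of_residual/of_semi]; exact: scrambled_cantor_families_of_far_orbit.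
- exact: proximal_unstable_of_scrambled_cantor_families.
- exact: dense_cell_far_orbit_of_unstable.
- by move=> /to_residual[q /of_residual].
Qed.
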